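(* Let $C\ge1$ and let $G$ be a simple $n$-vertex graph with maximum degree at most $\Delta$ that is properly $(\Delta+C)$-edge colored except for a newly inserted uncolored edge $e=(u,v)$. Let $\beta=\log_{(C+1)}\frac{n}{\Delta+C^2}+2$. If the girth $g$ of $G$ satisfies $g\ge2\beta+1$, then the following procedure extends the coloring to $e$ with recourse $R<\beta$: build the shift-tree of $G$ with respect to $(u,v)$ level by level until some expanded node $x$ with parent $p$ is such that, after shifting colors along the tree path from $(u,v)$ to $(p,x)$ so that $(p,x)$ is uncolored, $p$ and $x$ share an available color; then perform that shift and color $(p,x)$ with such a color. In particular, for $C=O(1)$, girth $g=\Omega(\log\frac{n}{\Delta})$ guarantees recourse $O(\log\frac n\Delta)$, and for $C=\Omega(\sqrt\Delta)$, girth $g=\Omega(\frac{\log n}{\log\Delta})$ guarantees recourse $O(\frac{\log n}{\log\Delta})$.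
   Context: For a vertex $w$, $A(w)$ is the set of colors (among the $\Delta+C$) not used on edges incident to $w$. Shifting colors along a chain of edges $[e_1,\dots,e_k]$ (consecutive edges sharing one endpoint) means giving each $e_i$ the current color of $e_{i+1}$ and leaving $e_k$ uncolored. Shift-tree $T$ with respect to the uncolored edge $(u,v)$: $v$ is the root, $u$ is regarded as the parent of $v$ but is not in $T$; each leaf is active or inactive, the root is active. Given levels $0..i$, level $i+1$ is built as follows: inactive leaves stay leaves; for an active leaf $x$ with parent $p$, a vertex $y$ is made a child of $x$ iff $(x,y)$ is an edge of $G$ and $\mathrm{color}(x,y)\in A'(p)$, where $A'(p)$ is the set of colors available at $p$ after shifting colors along the path in $T$ from $(u,v)$ to $(p,x)$ so that $(p,x)$ becomes uncolored; the new child $y$ is active if this is the first occurrence of vertex $y$ in $T$ and inactive otherwise. Recourse = number of previously colored edges whose color changes. The girth is the length of a shortest cycle.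
   Formalization: The girth hypothesis is g ≥ 2⌈β⌉+1 instead of g ≥ 2β+1 (the printed bound fails for some non-integral β); β > 0 is assumed; in the C = O(1) clause n/Δ ≥ t for a fixed t > 1, with constants depending on t. *)

(* Defs.v *)
(* MathComp / MathComp-Analysis *)
From HB Require Import structures.
From mathcomp Require Import all_boot all_order all_algebra.
From mathcomp Require Import all_classical all_reals.
From mathcomp Require Import ereal exp.

Set Implicit Arguments.
Unset Strict Implicit.
Unset Printing Implicit Defensive.

Import Order.TTheory GRing.Theory Num.Theory.

Section Graph.
Variables (V : finType) (adj : rel V).

Definition simple_graph : Prop := symmetric adj /\ irreflexive adj.

Definition degree (x : V) : nat := #|[set y | adj x y]|.

Definition edges : {set {set V}} :=
  [set e | [exists x, exists y, adj x y && (e == [set x; y])]].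

Definition is_cycle (c : seq V) : Prop := ucycle adj c /\ 2 < size c.

(* +oo for a forest; otherwise the infimum is attained, since lengths are
   natural numbers. *)
Definition girth (R : realType) : \bar R :=
  ereal_inf [set ((size c)%:R)%:E | c in is_cycle]%classic.

End Graph.

Section Coloring.
Variables (V : finType) (adj : rel V) (K : finType).

(* A partial edge coloring; None means uncolored.  Only the values on the edges
   {x, y} of the graph are ever used. *)
Definition pcoloring : Type := {set V} -> option K.

Definition proper_coloring (col : pcoloring) : Prop :=
  forall x y z, adj x y -> adj x z -> y != z ->
    col [set x; y] != None -> col [set x; y] != col [set x; z].

Definition all_colored (col : pcoloring) : Prop :=
  forall x y, adj x y -> col [set x; y] != None.

Definition avail (col : pcoloring) (w : V) : {set K} :=
  [set a | [forall y, adj w y ==> (col [set w; y] != Some a)]].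

(* Simultaneous: every edge of the chain receives the color that its successor
   had in col, and the last one becomes uncolored. *)
Definition shift_chain (col : pcoloring) (chain : seq {set V}) : pcoloring :=
  fun e => if e \in chain then
             nth None (map col chain) (index e chain).+1
           else col e.

Definition recourse (col col' : pcoloring) : nat :=
  #|[set e in edges adj | (col e != None) && (col' e != col e)]|.

End Coloring.

Section ShiftTree.
Variables (V : finType) (adj : rel V) (K : finType).
Variables (col : pcoloring V K) (u v : V).

(* A node of the shift-tree is its occurrence of a vertex x, together with the
   list of the vertices of its proper ancestors, from the root v to the parent
   of x; for the root this list is empty. *)
Definition node : Type := (seq V * V)%type.
Definition root : node := ([::], v).

(* u counts as the parent of the root *)
Definition parent (nd : node) : V := last u nd.1.

(* the chain of edges from (u,v) to (p,x), where p is the parent of x *)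
Definition chain (nd : node) : seq {set V} :=
  pairmap (fun y z => [set y; z]) u (rcons nd.1 nd.2).

Definition shifted (nd : node) : pcoloring V K := shift_chain col (chain nd).

Definition avail_parent (nd : node) : {set K} :=
  avail adj (shifted nd) (parent nd).

Definition shared (nd : node) : {set K} :=
  avail_parent nd :&: avail adj (shifted nd) nd.2.

Definition is_child (nd : node) (y : V) : bool :=
  adj nd.2 y && [exists a in avail_parent nd, col [set nd.2; y] == Some a].

Definition children (nd : node) : seq node :=
  [seq (rcons nd.1 nd.2, y) | y <- enum V & is_child nd y].

(* Flags each new node as active iff its vertex has not occurred before, where
   seen lists the vertices occurring in the tree so far. *)
Fixpoint mark (seen : seq V) (s : seq node) : seq (node * bool) :=
  if s is nd :: s' then (nd, nd.2 \notin seen) :: mark (nd.2 :: seen) s'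
  else [::].

(* The order in which the nodes of a new level are created decides which one is
   the first occurrence of its vertex; this order is left arbitrary and given by
   a rearrangement ord of the list of new nodes. *)
Variable ord : seq node -> seq node.

(* Vertices occurring in levels 0..i, and level i with its activity flags. *)
Fixpoint build (i : nat) : seq V * seq (node * bool) :=
  if i is j.+1 then
    let: (seen, lvl) := build j in
    let new := mark seen
      (ord (flatten [seq children nf.1 | nf <- lvl & nf.2])) in
    (seen ++ [seq nf.1.2 | nf <- new], new)
  else ([:: v], [:: (root, true)]).

Definition level (i : nat) : seq (node * bool) := (build i).2.

(* The procedure stops at the first level having an active node that shares an
   available color with its parent after the shift.  Any such node nd of that
   level and any such color a may be used. *)
Definition stops_at (i : nat) (nd : node) (a : K) : Prop :=
  [/\ (nd, true) \in level i, a \in shared nd &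
      forall j nd', j < i -> (nd', true) \in level j -> shared nd' = finset.set0].

Definition recolored (nd : node) (a : K) : pcoloring V K :=
  fun e => if e == [set parent nd; nd.2] then Some a else shifted nd e.

Definition procedure_output (col' : pcoloring V K) : Prop :=
  exists i nd a, stops_at i nd a /\ col' = recolored nd a.

End ShiftTree.

Section Procedure.
Variables (V : finType) (adj : rel V).

Record insertion_instance (Delta C : nat) (u v : V)
    (col : pcoloring V 'I_(Delta + C)) : Prop := {
  ins_simple : simple_graph adj;
  ins_degree : forall x, degree adj x <= Delta;
  ins_edge : adj u v;
  ins_proper : proper_coloring adj col;
  ins_uncolored : forall x y, adj x y ->
    (col [set x; y] == None) = ([set x; y] == [set u; v])
}.

(* However the nondeterministic choices are made, the procedure stops and its
   output is a proper coloring of all edges whose recourse satisfies good. *)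
Definition procedure_extends (K : finType) (u v : V) (col : pcoloring V K)
    (good : nat -> Prop) : Prop :=
  forall ord : seq (node V) -> seq (node V),
    (forall s, perm_eq (ord s) s) ->
    (exists col', procedure_output adj col u v ord col') /\
    (forall col', procedure_output adj col u v ord col' ->
       [/\ proper_coloring adj col', all_colored adj col' & good (recourse adj col col')]).

End Procedure.

Local Open Scope ring_scope.

(* beta bounds a number of tree levels.  It is kept real here, and rounded up to
   an integer where it is compared with the girth: with 2 * beta + 1 <= girth for
   a non-integral beta, two nodes of the last level may coincide and the bound
   can fail.  It fails e.g. for a graph with n = 114, Delta = 8, C = 6 and girth 6
   obtained from the affine plane of order 7, where beta < 2.49, 2 * beta + 1 < 6
   and the recourse is 3.  Also beta > 0 whenever Delta < n, but a Delta of order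
   (C + 1) ^ 2 * n would make it nonpositive. *)
Definition beta (R : realType) (n Delta C : nat) : R :=
  ln (n%:R / (Delta%:R + C%:R ^+ 2)) / ln (C%:R + 1) + 2.

(* Main.v *)
Require Import Defs.
From HB Require Import structures.
From mathcomp Require Import all_boot all_order all_algebra.
From mathcomp Require Import all_classical all_reals.
From mathcomp Require Import ereal exp.
From mathcomp Require Import fintype path finset zify ring lra.

Set Implicit Arguments.
Unset Strict Implicit.
Unset Printing Implicit Defensive.

(* Let L be the ceiling of beta.  As the girth exceeds 2L, walks of length at
   most L from v in the shift-tree never revisit a vertex, and distinct ones have
   distinct endpoints; hence every node of the levels 0..L is active, and
   shifting along its chain keeps the coloring proper.  If x does not share a
   color with its parent p, every color available at p after the shift leads to
   a child of x, so x has at least Delta + C + 1 - deg p >= C + 1 children.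
   Suppose no node of the levels below L shares a color with its parent.  A node
   x of level L - 2, its neighbors other than its parent, and its grandchildren
   then number at least
     deg x + (C + 1) (Delta + C + 1 - deg x) >= Delta + (C + 1) ^ 2,
   and these families are disjoint for the (C + 1) ^ (L - 2) or more choices
   of x, which is more than n vertices.  For L = 1 the sizes of the two sets of
   colors available at u and v give the contradiction. *)

(** * Simple walks and girth *)

Section SimpleWalks.
Variables (V : finType) (adj : rel V).
Hypotheses (adjS : symmetric adj) (adjI : irreflexive adj).

Definition girth_gt (m : nat) : Prop := forall c, is_cycle adj c -> m < size c.

(** If [y] already occurred, the walk from that occurrence through [z] back to [y] would close a
    cycle of at most [size p + 2] vertices. The condition [y != last x p] excludes merely stepping
    back along the last edge, which closes no cycle. *)
Lemma uniq_walk_rcons m x p z y :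
  girth_gt m -> size p + 2 <= m -> path adj x (rcons (rcons p z) y) ->
  uniq (x :: rcons p z) -> y != last x p -> uniq (x :: rcons (rcons p z) y).
Proof.
move=> Hm sz Hp U yl; rewrite -rcons_cons rcons_uniq U andbT.
rewrite -rcons_cons mem_rcons inE negb_or.
apply/andP; split.
  move: Hp; rewrite rcons_path last_rcons => /andP[_ a].
  by apply: contraTneq a => ->; rewrite adjI.
apply/negP => yin.
have [s1 [s2 E]] : exists s1 s2, x :: p = s1 ++ y :: s2.
  by case/splitPr: yin => a b; exists a, b.
have Hs : path adj y (rcons (rcons s2 z) y).
  have : sorted adj (rcons (rcons (x :: p) z) y) by [].
  by rewrite E !rcons_cat => /cat_sorted2[_].
have Us : uniq (y :: rcons s2 z).
  by move: U; rewrite -rcons_cons E rcons_cat cat_uniq => /and3P[].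
have s2n : 0 < size s2.
  case: s2 E {Hs Us} => // E; case/negP: yl.
  by rewrite -(last_cons x) E last_cat.
have szE : (size p).+1 = size s1 + (size s2).+1.
  by rewrite -[LHS]/(size (x :: p)) E size_cat.
have := Hm (y :: rcons s2 z).
rewrite /= size_rcons => H; have : m < (size s2).+2.
  by apply: H; split; rewrite /= ?size_rcons //; apply/andP; split.
by lia.
Qed.

(** Common first steps are stripped by induction. Once the paths diverge at [x], the cycle follows
    [p] up to the first vertex [w] that lies on [q], then returns to [x] along [q]. *)
Lemma simple_paths_cycle x p q :
  path adj x p -> path adj x q -> uniq (x :: p) -> uniq (x :: q) ->
  last x p = last x q -> p <> q ->
  exists2 c, is_cycle adj c & size c <= size p + size q.
Proof.
elim: p x q => [|a p IH] x [|b q] //.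
- by move=> _ _ _ /andP[+ _] /= E; rewrite E mem_last.
- by move=> _ _ /andP[+ _] _ /= E; rewrite -E mem_last.
have [<-|ab] := eqVneq a b.
  move=> /andP[_ Pp] /andP[_ Pq] /andP[_ Up] /andP[_ Uq] El pq.
  have [|c Hc sz] := IH a q Pp Pq Up Uq El; first by move=> E; apply: pq; rewrite E.
  by exists c => //=; lia.
rewrite 2!(cons_uniq x) => Pp Pq /andP[xp Up] /andP[xq Uq] El _.
have Hh : has (mem (b :: q)) (a :: p).
  apply/hasP; exists (last a p); first exact: mem_last.
  by move: El => /= ->; exact: mem_last.
have [w [p1 [p2 [Ep wq nh]]]] : exists w p1 p2,
    [/\ a :: p = rcons p1 w ++ p2, w \in b :: q & ~~ has (mem (b :: q)) p1].
  by case: (split_find Hh) => w s1 s2 w1 w2; exists w, s1, s2.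
have [q1 [q2 Eq]] : exists q1 q2, b :: q = rcons q1 w ++ q2.
  by case/path.splitP: wq => q1 q2; exists q1, q2.
exists (x :: rcons p1 w ++ rev q1); last first.
  have := congr1 size Ep; have := congr1 size Eq.
  by rewrite /= !size_cat !size_rcons size_rev; lia.
(* If both arcs were bare edges, then [a = w = b]. So the closed walk has at least three
   vertices. *)
have n12 : 0 < size p1 + size q1.
  case: (p1) Ep (q1) Eq => [|? ?] //= [Ea _] [|? ?] //= [Eb _].
  by move: ab; rewrite Ea Eb eqxx.
split; last by rewrite /= size_cat size_rcons size_rev; lia.
move: Pp Pq Up Uq xp xq nh; rewrite Ep Eq !cat_path !cat_uniq !mem_cat !negb_or.
move=> /andP[Pp _] /andP[Pq _] /andP[Up _] /andP[Uq _] /andP[xp _] /andP[xq _] nh.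
apply/andP; split.
  rewrite /= rcons_cat cat_path Pp last_rcons -rev_cons.
  have -> : w = last x (rcons q1 w) by rewrite last_rcons.
  have -> : x :: q1 = belast x (rcons q1 w) by rewrite belast_rcons.
  by rewrite rev_path (eq_path (e' := adj)).
rewrite cons_uniq mem_cat negb_or xp mem_rev cat_uniq Up rev_uniq.
move: xq Uq; rewrite rcons_uniq mem_rcons inE negb_or => /andP[_ ->] /andP[wq1 ->].
rewrite !andbT /=; apply/hasPn => z; rewrite mem_rev => zq.
rewrite /= mem_rcons inE negb_or; apply/andP; split.
  by apply: contraNneq wq1 => <-.
apply: contra nh => zp; apply/hasP; exists z => //=.
by rewrite mem_cat mem_rcons inE zq orbT.
Qed.
End SimpleWalks.

(** * Shifting colors along a chain *)

Section Colorings.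
Variables (V : finType) (adj : rel V) (K : finType).
Implicit Types (col : pcoloring V K) (e : {set V}) (c : option K).

Definition assign col e c : pcoloring V K := fun e' => if e' == e then c else col e'.

Lemma eq_set2l (x y z : V) : ([set x; y] == [set x; z]) = (y == z).
Proof.
apply/eqP/eqP => [E|-> //].
have : y \in [set x; z] by rewrite -E set22.
have : z \in [set x; y] by rewrite E set22.
by rewrite !in_set2 => /orP[]/eqP-> // /orP[]/eqP.
Qed.

Lemma proper_assign col p x a :
  proper_coloring adj col -> a \in avail adj col p -> a \in avail adj col x ->
  proper_coloring adj (assign col [set p; x] (Some a)).
Proof.
move=> pc ap ax.
have key s y z : [set s; y] = [set p; x] -> adj s z -> col [set s; z] != Some a.
  move=> E az; have : s \in [set p; x] by rewrite -E set21.
  rewrite in_set2 => /orP[] /eqP Es; move: ap ax; rewrite -Es !inE.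
    by move=> /forallP/(_ z); rewrite az.
  by move=> _ /forallP/(_ z); rewrite az.
move=> s y z ay az yz; rewrite /assign.
have [Ey|ny] := eqVneq [set s; y]; have [Ez|nz] := eqVneq [set s; z].
- by move: yz; rewrite -(eq_set2l s) Ey Ez eqxx.
- by move=> _; rewrite eq_sym; apply: key Ey az.
- by move=> _; apply: key Ez ay.
- exact: pc.
Qed.

Lemma proper_unassign col e :
  proper_coloring adj col -> proper_coloring adj (assign col e None).
Proof.
move=> pc s y z ay az yz; rewrite /assign.
by case: ifP => // _; case: ifP => // _; exact: pc.
Qed.

Lemma avail_unassign col e w : avail adj col w \subset avail adj (assign col e None) w.
Proof.
apply/subsetP => a; rewrite !inE => /forallP h; apply/forallP => y.
by apply/implyP => ay; rewrite /assign; case: ifP => // _; exact: (implyP (h y)).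
Qed.

(** By properness no other edge at [w] carries [a], so uncoloring this one frees it. *)
Lemma avail_unassign_edge col w y a :
  proper_coloring adj col -> adj w y -> col [set w; y] = Some a ->
  a \in avail adj (assign col [set w; y] None) w.
Proof.
move=> pc ay cy; rewrite inE; apply/forallP => z; apply/implyP => az.
rewrite /assign eq_set2l; have [//|zy] := eqVneq z y; rewrite -cy eq_sym.
by apply: pc => //; rewrite ?cy // eq_sym.
Qed.

Lemma card_avail col p x : adj p x -> col [set p; x] = None ->
  #|K| < #|avail adj col p| + degree adj p.
Proof.
move=> px cpx; set S := [set y | adj p y & col [set p; y] != None].
have h1 : #|~: avail adj col p| <= #|S|.
  have SI : injective (@Some K) by move=> ? ? [].
  rewrite -(card_imset _ SI).
  apply: leq_trans (leq_imset_card (fun y => col [set p; y]) S).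
  apply: subset_leq_card; apply/subsetP => _ /imsetP[a + ->].
  rewrite !inE negb_forall => /existsP[y]; rewrite negb_imply negbK => /andP[py /eqP E].
  by apply/imsetP; exists y => //; rewrite inE py E.
have h2 : #|S| < degree adj p.
  apply: proper_card; apply/properP; split.
    by apply/subsetP => y; rewrite !inE => /andP[].
  by exists x; rewrite !inE ?px // cpx eqxx andbF.
by rewrite -(cardsC (avail adj col p)); lia.
Qed.
End Colorings.

Section ChainShift.
Variables (V : finType) (K : finType) (col : pcoloring V K) (u : V).

Lemma mem_walk_edge s x e w :
  e \in pairmap (fun y z : V => [set y; z]) x s -> w \in e -> w \in x :: s.
Proof.
elim: s x => //= a s IH x; rewrite inE => /orP[/eqP ->|h /(IH _ h)].
  by rewrite !inE => /orP[] ->; rewrite ?orbT.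
by rewrite [w \in x :: _]inE => ->; rewrite orbT.
Qed.

Lemma chainE (nd : node V) :
  chain u nd = rcons (pairmap (fun y z : V => [set y; z]) u nd.1) [set parent u nd; nd.2].
Proof. by rewrite /chain -cats1 pairmap_cat /= cats1. Qed.

(** Reduces the simultaneous shift to an incremental one: lengthening the chain by an edge affects
    only its last two edges. Simplicity of the walk makes the chain edges distinct, so that [index]
    finds the right position. *)
Lemma shifted_child (nd : node V) y :
  uniq (u :: rcons (rcons nd.1 nd.2) y) ->
  shifted col u (rcons nd.1 nd.2, y) =
  assign (assign (shifted col u nd) [set nd.2; y] None)
         [set parent u nd; nd.2] (col [set nd.2; y]).
Proof.
case: nd => s x; rewrite [(s, x).1]/= [(s, x).2]/= -2!rcons_cons 2!rcons_uniq => /and3P[ys xs _].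
apply: funext => e; rewrite /shifted /shift_chain !chainE /= /assign /parent /=.
rewrite -(cats1 s x) pairmap_cat last_cat /=.
set c0 := pairmap _ u s; set g := [set last u s; x]; set f := [set x; y].
have gc : g \notin c0 by apply: contra xs => h; apply: mem_walk_edge h _; rewrite set22.
have fc : f \notin c0.
  by apply: contra ys => h; rewrite mem_rcons inE (mem_walk_edge h) ?orbT // set22.
have fg : g != f.
  rewrite /g /f setUC eq_set2l; apply: contraNneq ys => <-.
  by rewrite mem_rcons inE mem_last orbT.
rewrite -!cats1 -catA /= !map_cat !mem_cat !index_cat !inE /= [g == e]eq_sym [f == e]eq_sym.
have [->|eg] := eqVneq e g.
  by rewrite (negPf gc) /= nth_cat size_map addn0 ltnNge leqnSn /= subSnn.
(* [f] is last in the chain, so its successor position is past the end and [nth] returns the default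
   [None]. *)
have [->|ef] := eqVneq e f.
  rewrite (negPf fc) /= nth_cat size_map addn1 ltnNge (leq_trans (leqnSn _) (leqnSn _)) /=.
  by rewrite -addn2 addKn.
(* An edge of [c0] has the same successor in both chains; for the last edge of [c0] that successor
   is [g]. *)
rewrite !orbF; case: ifP => // ec; rewrite ?ec !nth_cat size_map.
case: ltnP => // h; have hi : index e c0 < size c0 by rewrite index_mem.
by have -> : (index e c0).+1 - size c0 = 0 by lia.
Qed.
End ChainShift.

(** * Invariants of the shifted coloring at a tree node *)

Section ShiftNodes.
Variables (V : finType) (adj : rel V) (K : finType) (col : pcoloring V K) (u v : V).
Hypotheses (adjS : symmetric adj) (adjI : irreflexive adj).
Implicit Types nd : node V.

Definition simple_walk nd : bool :=
  [&& path adj u (rcons nd.1 nd.2), uniq (u :: rcons nd.1 nd.2)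
    & head u (rcons nd.1 nd.2) == v].

Lemma simple_walk_root : adj u v -> simple_walk (Defs.root v).
Proof.
move=> adjuv; rewrite /simple_walk /= adjuv eqxx inE !andbT.
by apply: contraTneq adjuv => ->; rewrite adjI.
Qed.

Lemma simple_walk_rcons m nd y :
  girth_gt adj m -> size nd.1 + 2 <= m -> simple_walk nd -> adj nd.2 y ->
  y != parent u nd -> simple_walk (rcons nd.1 nd.2, y).
Proof.
case: nd => s x gm sz /and3P[p w h] a ne.
have p' : path adj u (rcons (rcons s x) y) by rewrite rcons_path p last_rcons.
apply/and3P; split => //; first exact: uniq_walk_rcons gm sz p' w ne.
by case: (s) h.
Qed.

Lemma simple_walk_from_root nd : simple_walk nd ->
  exists t, [/\ rcons nd.1 nd.2 = v :: t, size t = size nd.1, path adj v t,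
                uniq (v :: t) & last v t = nd.2].
Proof.
case: nd => s x /and3P[]; rewrite [(s, x).1]/= [(s, x).2]/= => p w h.
have [t E] : exists t, rcons s x = v :: t.
  by case: (rcons s x) (size_rcons s x) h => // a t _ /eqP <-; exists t.
exists t; move: p w; rewrite E => /= /andP[_ ->] /andP[_ ->]; split => //.
  by have := congr1 size E; rewrite size_rcons /= => -[].
by rewrite -(last_cons u) -E last_rcons.
Qed.

(** Measured from [v], both walks have at most [m] edges, so two different ones with a common end
    would yield a cycle of length at most [2 * m]. *)
Lemma simple_walk_inj m nd nd' :
  girth_gt adj (2 * m) -> simple_walk nd -> simple_walk nd' ->
  size nd.1 <= m -> size nd'.1 <= m -> nd.2 = nd'.2 -> nd = nd'.
Proof.
move=> gm /simple_walk_from_root[t [E st pt ut lt]].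
move=> /simple_walk_from_root[t' [E' st' pt' ut' lt']] sm sm' ends.
have [tt|/eqP ntt] := eqVneq t t'.
  case: nd nd' E E' {st st' lt lt' sm sm' ends} => [s x] [s' x'] /= E E'.
  by apply: rcons_inj; rewrite E E' tt.
have [|c cc sc] := simple_paths_cycle adjS pt pt' ut ut' _ ntt; first by rewrite lt lt'.
by have := gm _ cc; lia.
Qed.

(** The invariant carried down the tree. [good_freed] records that the original color of the last
    edge has moved to the preceding edge at the parent; this is what keeps the parent from being
    listed among the children. At the root it is vacuous, since the edge from [u] to [v] has no
    color. *)
Record good_node nd : Prop := {
  good_walk : simple_walk nd;
  good_proper : proper_coloring adj (shifted col u nd);
  good_uncolored : forall x y, adj x y ->
    (shifted col u nd [set x; y] == None) = ([set x; y] == [set parent u nd; nd.2]);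
  good_freed : forall a, col [set parent u nd; nd.2] = Some a ->
    a \notin avail_parent adj col u nd
}.

Lemma adj_parent nd : simple_walk nd -> adj (parent u nd) nd.2.
Proof. by case/and3P; rewrite rcons_path => /andP[]. Qed.

(** On a simple walk the only chain edge containing the end vertex is the last one. *)
Lemma shifted_end nd y : simple_walk nd -> y != parent u nd ->
  shifted col u nd [set nd.2; y] = col [set nd.2; y].
Proof.
case/and3P => _ w _ ne; rewrite /shifted /shift_chain chainE mem_rcons inE setUC.
rewrite [X in _ == X]setUC [X in X == _]setUC eq_set2l (negPf ne) /=.
case: ifP => // h; move: w; rewrite -rcons_cons rcons_uniq => /andP[/negP[]].
by apply: mem_walk_edge h _; rewrite set22.
Qed.

Hypothesis adjuv : adj u v.
Hypothesis (col_proper : proper_coloring adj col).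
Hypothesis (col_uncolored : forall x y, adj x y ->
  (col [set x; y] == None) = ([set x; y] == [set u; v])).

Lemma good_root : good_node (Defs.root v).
Proof.
have cuv : col [set u; v] = None by apply/eqP; rewrite col_uncolored.
have E : shifted col u (Defs.root v) = col.
  apply: funext => e; rewrite /shifted /shift_chain /chain /= inE.
  by have [->|//] := eqVneq; rewrite cuv.
split; rewrite ?E //; first exact: simple_walk_root.
by rewrite /parent /= cuv.
Qed.

Lemma is_child_neq_parent nd y : good_node nd -> is_child adj col u nd y -> y != parent u nd.
Proof.
case=> _ _ _ fr /andP[_ /existsP[a /andP[aa /eqP ca]]].
by apply: contraTneq aa => yp; apply: fr; rewrite setUC -yp.
Qed.

(** With p the parent and x the vertex of [nd], uncoloring the edge from x to [y] frees its color
    [a] at x, and [a] is available at p because [y] is a child. So giving [a] to the edge from p to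
    x keeps the coloring proper. *)
Lemma good_child m nd y : girth_gt adj m -> size nd.1 + 2 <= m ->
  good_node nd -> is_child adj col u nd y -> good_node (rcons nd.1 nd.2, y).
Proof.
move=> gm sz gnd cy; have ne := is_child_neq_parent gnd cy.
case: gnd => w pr un fr; case/andP: cy => axy /existsP[a /andP[aa /eqP ca]].
have w' := simple_walk_rcons gm sz w axy ne.
have apx := adj_parent w.
have U : uniq (u :: rcons (rcons nd.1 nd.2) y) by case/and3P: w'.
have sxy : shifted col u nd [set nd.2; y] = Some a by rewrite shifted_end.
have E := shifted_child col U; rewrite ca in E.
have Ep : parent u (rcons nd.1 nd.2, y) = nd.2 by rewrite /parent last_rcons.
have ne' : [set nd.2; y] != [set parent u nd; nd.2].
  by rewrite [X in _ != X]setUC eq_set2l.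
split; rewrite ?Ep.
- exact: w'.
- rewrite E; apply: proper_assign.
  + exact: proper_unassign.
  + exact: (subsetP (avail_unassign _ _ _ _)).
  + exact: avail_unassign_edge.
- move=> s t ast; rewrite E /assign.
  have [->|ng] := eqVneq [set s; t] [set parent u nd; nd.2].
    by rewrite [RHS]eq_sym (negPf ne').
  by case: ifP => // _; rewrite un // (negPf ng).
(* The color of the new last edge now sits on the edge back to the old parent, so it is used at the
   new parent [nd.2]. *)
- move=> b; rewrite ca => -[<-]; rewrite /avail_parent Ep inE negb_forall.
  apply/existsP; exists (parent u nd); rewrite adjS apx /= negbK E /assign.
  by rewrite (finset.setUC [set nd.2] [set parent u nd]) eqxx.
Qed.

Lemma card_avail_parent nd : good_node nd ->
  #|K| < #|avail_parent adj col u nd| + degree adj (parent u nd).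
Proof.
case=> w _ un _; apply: (@card_avail _ _ _ _ _ nd.2); first exact: adj_parent.
by apply/eqP; rewrite un ?adj_parent.
Qed.

(** With nothing shared, every color available at the parent occurs on an edge at [nd.2]. That edge
    does not lead to the parent, being colored, so its other end is a child; different colors give
    different children. *)
Lemma size_children nd : good_node nd -> shared adj col u nd = set0 ->
  #|avail_parent adj col u nd| <= size (children adj col u nd).
Proof.
move=> gnd sh; set ys := [seq y <- enum V | is_child adj col u nd y].
have uys : uniq ys by rewrite filter_uniq ?enum_uniq.
rewrite size_map -/ys -(card_uniqP uys).
have SI : injective (@Some K) by move=> ? ? [].
rewrite -(card_imset _ SI).
apply: leq_trans (leq_imset_card (fun y => col [set nd.2; y]) (mem ys)).
apply: subset_leq_card; apply/subsetP => _ /imsetP[a aa ->].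
have : a \notin shared adj col u nd by rewrite sh inE.
rewrite inE aa /= inE negb_forall => /existsP[y].
rewrite negb_imply negbK => /andP[ay /eqP cy].
have yp : y != parent u nd.
  apply: contraTneq isT => yp; have := good_uncolored gnd ay.
  by rewrite cy yp setUC eqxx.
rewrite (shifted_end (good_walk gnd) yp) in cy.
apply/imsetP; exists y => //.
by rewrite mem_filter mem_enum /is_child ay andbT /=; apply/existsP; exists a; rewrite aa cy /=.
Qed.

(** The available sets at [u] and [v] are disjoint subsets of [K], and each has more than [#|K|]
    minus the degree many elements. *)
Lemma root_unshared_degree : shared adj col u (Defs.root v) = set0 ->
  #|K| + 2 <= degree adj u + degree adj v.
Proof.
move=> sh; have gr := good_root.
have h1 : #|K| < #|avail_parent adj col u (Defs.root v)| + degree adj u := card_avail_parent gr.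
have h2 : #|K| < #|avail adj (shifted col u (Defs.root v)) v| + degree adj v.
  apply: (@card_avail _ _ _ _ _ u); first by rewrite adjS.
  by apply/eqP; rewrite setUC (good_uncolored gr) ?eqxx.
have : #|avail_parent adj col u (Defs.root v)| + #|avail adj (shifted col u (Defs.root v)) v| <= #|K|.
  by rewrite -cardsUI; rewrite /shared in sh; rewrite sh cards0 addn0 max_card.
by move: h1 h2; lia.
Qed.
End ShiftNodes.

(** * Levels of the shift-tree *)

Section NodeLists.
Variable V : finType.
Implicit Types (s : seq (node V)) (f : node V -> seq V).

Lemma uniq_flatten_rcons f s : uniq s -> (forall nd, uniq (f nd)) ->
  uniq (flatten [seq [seq (rcons nd.1 nd.2, y) | y <- f nd] | nd <- s]).
Proof.
move=> us uf; apply: allpairs_uniq_dep => // -[[a x] y] [[a' x'] y'] _ _ /=.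
by case=> /rcons_inj[-> ->] ->.
Qed.

Lemma size_flatten_map (S T : Type) (g : S -> seq T) (r : seq S) :
  size (flatten (map g r)) = \sum_(x <- r) size (g x).
Proof. by rewrite size_flatten sumnE /shape -map_comp big_map. Qed.

Lemma leq_sum_const (T : eqType) (r : seq T) (F : T -> nat) c :
  {in r, forall x, c <= F x} -> c * size r <= \sum_(x <- r) F x.
Proof.
elim: r => [|x r IH] h; first by rewrite big_nil muln0.
rewrite big_cons mulnS leq_add ?h ?mem_head // IH // => y yr.
by apply: h; rewrite inE yr orbT.
Qed.

Lemma mark_fresh seen s : uniq (map snd s) -> {in s, forall nd, nd.2 \notin seen} ->
  mark seen s = [seq (nd, true) | nd <- s].
Proof.
elim: s seen => //= nd s IH seen /andP[nds us] fresh.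
rewrite (fresh nd) ?mem_head // IH // => nd' nds'.
rewrite inE negb_or (fresh nd') ?inE ?nds' ?orbT // andbT.
by apply: contraNneq nds => <-; apply/mapP; exists nd'.
Qed.
End NodeLists.

Section Levels.
Variables (V : finType) (adj : rel V) (K : finType) (col : pcoloring V K) (u v : V).
Hypotheses (adjS : symmetric adj) (adjI : irreflexive adj) (adjuv : adj u v).
Hypothesis (col_proper : proper_coloring adj col).
Hypothesis (col_uncolored : forall x y, adj x y ->
  (col [set x; y] == None) = ([set x; y] == [set u; v])).
Variables (L : nat) (ord : seq (node V) -> seq (node V)).
Hypotheses (L_gt0 : 0 < L) (girthL : girth_gt adj (2 * L)).
Hypothesis ordP : forall s, perm_eq (ord s) s.

(* With every node active, the levels of the shift-tree obey this recursion. *)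
Fixpoint nodes (i : nat) : seq (node V) :=
  if i is j.+1 then ord (flatten (map (children adj col u) (nodes j)))
  else [:: Defs.root v].

Lemma mem_nodes i nd : i <= L -> nd \in nodes i ->
  good_node adj col u v nd /\ size nd.1 = i.
Proof.
elim: i nd => [|i IH] nd iL /=.
  by rewrite inE => /eqP ->; split=> //; exact: good_root.
rewrite (perm_mem (ordP _)) => /flatten_mapP[nd0 nd0i /mapP[y + ->]].
have [g0 s0] := IH _ (ltnW iL) nd0i.
rewrite mem_filter => /andP[cy _]; split; last by rewrite size_rcons s0.
(* The length condition is [i + 2 <= 2 * L], which follows from [i < L] and [0 < L]. *)
by apply: (good_child adjS adjI girthL) => //; rewrite s0; lia.
Qed.

Lemma uniq_nodes i : uniq (nodes i).
Proof.
elim: i => //= i IH; rewrite (perm_uniq (ordP _)).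
by apply: uniq_flatten_rcons => // nd; rewrite filter_uniq ?enum_uniq.
Qed.

Lemma simple_walks_uniq (s : seq (node V)) : uniq s ->
  {in s, forall nd, simple_walk adj u v nd /\ size nd.1 <= L} -> uniq (map snd s).
Proof.
move=> us h; rewrite map_inj_in_uniq // => nd nd' /h[w sz] /h[w' sz'].
exact: (simple_walk_inj adjS girthL w w' sz sz').
Qed.

(** No node is flagged inactive: two nodes with the same vertex are equal by [simple_walk_inj],
    while nodes of different levels have different lengths. *)
Lemma build_nodes i : i <= L -> build adj col u v ord i =
  (flatten [seq map snd (nodes j) | j <- iota 0 i.+1], [seq (nd, true) | nd <- nodes i]).
Proof.
elim: i => [//|i IH] iL; rewrite [LHS]/= IH ?(ltnW iL) //.
rewrite (_ : [seq _ | nf <- _ & _] = map (children adj col u) (nodes i)); last first.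
  by rewrite filter_map /= filter_predT -map_comp.
rewrite -/(nodes i.+1) mark_fresh.
- rewrite -map_comp (eq_map (_ : _ =1 snd)) //.
  by rewrite -[i.+2]addn1 iotaD map_cat flatten_cat /= cats0.
- apply: simple_walks_uniq; first exact: uniq_nodes.
  by move=> nd /(mem_nodes iL)[[w _ _ _] ->].
- move=> nd ndi; apply/negP => /flatten_mapP[j].
  rewrite mem_iota => /andP[_ ji] /mapP[nd' nd'j E].
  have [[w _ _ _] sz] := mem_nodes iL ndi.
  have [|[w' _ _ _] sz'] := mem_nodes _ nd'j; first by lia.
  have := simple_walk_inj adjS girthL w w'; rewrite sz sz' E => /(_ iL _ erefl) e.
  by have := sz; rewrite e ?sz'; lia.
Qed.

Lemma level_nodes i : i <= L -> level adj col u v ord i = [seq (nd, true) | nd <- nodes i].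
Proof. by move=> iL; rewrite /level build_nodes. Qed.

Lemma mem_level i nd b : i <= L -> ((nd, b) \in level adj col u v ord i) = b && (nd \in nodes i).
Proof.
move=> iL; rewrite level_nodes //; apply/mapP/andP => [[nd' h [-> ->]] //|[-> h]].
by exists nd.
Qed.

(** * Counting vertices when no level below [L] stops the procedure *)

Section Counting.
Variables Delta C : nat.
Hypothesis cardK : #|K| = Delta + C.
Hypothesis degree_le : forall x, degree adj x <= Delta.
Hypothesis unshared : forall j nd, j < L -> nd \in nodes j -> shared adj col u nd = set0.

Lemma size_children_nodes j nd : j < L -> nd \in nodes j ->
  Delta + C < size (children adj col u nd) + degree adj (parent u nd).
Proof.
move=> jL ndj; have [gnd _] := mem_nodes (ltnW jL) ndj.
have := card_avail_parent gnd; have := size_children gnd (unshared jL ndj).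
by rewrite cardK; lia.
Qed.

Lemma size_nodes j : j <= L -> (C + 1) ^ j <= size (nodes j).
Proof.
elim: j => // j IH jL; rewrite /= (perm_size (ordP _)) size_flatten_map expnS.
apply: leq_trans (leq_sum_const (c := C + 1) _); first by rewrite leq_mul2l IH ?orbT // ltnW.
move=> nd ndj; rewrite addn1 -(ltn_add2r (degree adj (parent u nd))).
by apply: leq_ltn_trans (size_children_nodes jL ndj); rewrite addnC leq_add2r.
Qed.

(** Also includes neighbors that are not children: walks to them are still simple, so they too count
    as distinct vertices. *)
Definition other_neighbors (nd : node V) : seq V :=
  [seq y <- enum V | adj nd.2 y & y != parent u nd].

Lemma size_other_neighbors nd : degree adj nd.2 <= (size (other_neighbors nd)).+1.
Proof.
apply: leq_trans (card_size (parent u nd :: other_neighbors nd)).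
apply: subset_leq_card; apply/subsetP => y; rewrite inE => ay.
by rewrite inE mem_filter mem_enum ay /= andbT orbN.
Qed.

Lemma walk_count l : L = l.+2 -> (C + 1) ^ l * (Delta + (C + 1) ^ 2) <= #|V|.
Proof.
move=> EL; pose A := nodes l.
pose B := flatten [seq [seq (rcons nd.1 nd.2, y) | y <- other_neighbors nd] | nd <- A].
(* Simple walks of lengths [l], [l + 1] and [l + 2 = L] from [v]; their endpoints are pairwise
   distinct vertices. *)
pose W := A ++ B ++ nodes L.
have hA nd : nd \in A -> simple_walk adj u v nd /\ size nd.1 = l.
  by move=> /(@mem_nodes l)[|[]] //; lia.
have hB nd : nd \in B -> simple_walk adj u v nd /\ size nd.1 = l.+1.
  case/flatten_mapP => nd0 /hA[w sz] /mapP[y + ->].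
  rewrite mem_filter => /andP[/andP[ay ne] _]; split; last by rewrite size_rcons sz.
  by apply: (simple_walk_rcons adjI girthL) => //; rewrite sz; lia.
have hN nd : nd \in nodes L -> simple_walk adj u v nd /\ size nd.1 = l.+2.
  by move=> /(mem_nodes (leqnn L))[[]]; rewrite -EL.
have uW : uniq W.
  rewrite !cat_uniq !uniq_nodes uniq_flatten_rcons ?uniq_nodes //; last first.
    by move=> nd; rewrite filter_uniq ?enum_uniq.
  rewrite andbT /=; apply/andP; split; apply/hasPn => nd.
    rewrite mem_cat => /orP[/hB|/hN] [_ sz]; apply/negP => /hA[_]; lia.
  by move=> /hN[_ sz]; apply/negP => /hB[_]; lia.
have sW : size W <= #|V|.
  rewrite -(size_map snd) -(card_uniqP _) ?max_card //.
  apply: simple_walks_uniq => // nd.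
  by rewrite !mem_cat => /or3P[/hA|/hB|/hN] [w sz]; split=> //; rewrite sz; lia.
apply: leq_trans sW; rewrite !size_cat.
have -> : size (nodes L) =
    \sum_(nd <- A) \sum_(c <- children adj col u nd) size (children adj col u c).
  rewrite EL [nodes _]/= (perm_size (ordP _)) size_flatten_map.
  by rewrite (perm_big _ (ordP _)) /= big_flatten /= big_map.
rewrite -(sum1_size A) size_flatten_map -!big_split /=.
apply: leq_trans (leq_sum_const (c := Delta + (C + 1) ^ 2) _).
  by rewrite mulnC leq_mul2l size_nodes ?orbT //; lia.
move=> nd ndA; rewrite size_map.
have lL : l < L by lia.
have h1 := size_other_neighbors nd.
have h2 := size_children_nodes lL ndA.
(* The vertex [nd.2] is the parent of each [c], so its own degree, not merely [Delta], governs the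
   number of grandchildren. A small degree thus costs neighbors but gains grandchildren. *)
have h3 : (Delta + C + 1 - degree adj nd.2) * size (children adj col u nd) <=
    \sum_(c <- children adj col u nd) size (children adj col u c).
  apply: leq_sum_const => c cc.
  have : c \in nodes l.+1.
    by rewrite /= (perm_mem (ordP _)); apply/flatten_mapP; exists nd.
  move=> /size_children_nodes => /(_ (_ : _ < _)) h; have := h _; rewrite EL => /(_ (ltnSn _)).
  by have /mapP[y _ ->] := cc; rewrite /parent /= last_rcons; lia.
have d1 := degree_le nd.2; have d2 := degree_le (parent u nd).
move: h1 h2 h3 d1 d2; set a := size _; set b := size _; set S := \sum_(_ <- _) _.
set d := degree _ _; set d' := degree _ _ => h1 h2 h3 d1 d2.
have h4 : (Delta + C + 1 - d) * (C + 1) <= S.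
  by apply: leq_trans h3; rewrite leq_mul2l; apply/orP; right; lia.
(* The node and its other neighbors give at least d, the grandchildren at least
   [(e + C + 1) * (C + 1)], which is at least [e + (C + 1) ^ 2]. *)
have [e Ee] : exists e, Delta = d + e by exists (Delta - d); lia.
by move: h4; rewrite Ee (_ : d + e + C + 1 - d = e + C + 1); nia.
Qed.
End Counting.
End Levels.

(** * Termination and correctness of the procedure *)

Section Stopping.
Variables (V : finType) (adj : rel V) (K : finType) (col : pcoloring V K) (u v : V).
Hypotheses (adjS : symmetric adj) (adjI : irreflexive adj) (adjuv : adj u v).
Hypothesis (col_proper : proper_coloring adj col).
Hypothesis (col_uncolored : forall x y, adj x y ->
  (col [set x; y] == None) = ([set x; y] == [set u; v])).

(** Only chain edges change color, and the first of them was uncolored, so it does not count as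
    recourse. This leaves one edge for each proper ancestor of the node. *)
Lemma recolored_extends nd a :
  good_node adj col u v nd -> a \in shared adj col u nd ->
  [/\ proper_coloring adj (recolored col u nd a), all_colored adj (recolored col u nd a)
    & recourse adj col (recolored col u nd a) <= size nd.1].
Proof.
move=> gnd; rewrite inE => /andP[ap ax].
split.
- exact: (proper_assign (good_proper gnd)).
- move=> x y axy; rewrite /recolored; case: ifP => // ne.
  by rewrite (good_uncolored gnd axy) ne.
have [t [Et st _ _ _]] := simple_walk_from_root (good_walk gnd).
have Ec : chain u nd = [set u; v] :: pairmap (fun y z : V => [set y; z]) v t.
  by rewrite /chain Et.
rewrite -st -(size_pairmap (fun y z : V => [set y; z]) v t).
apply: leq_trans (card_size _); apply: subset_leq_card; apply/subsetP => e.
rewrite inE => /and3P[_ ce re].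
have : e \in chain u nd.
  apply: contraNT re => ec; rewrite /recolored /shifted /shift_chain (negPf ec).
  rewrite ifN //; apply: contraNneq ec => ->.
  by rewrite chainE mem_rcons mem_head.
rewrite Ec inE => /orP[/eqP Ee|//].
by move: ce; rewrite Ee col_uncolored // eqxx.
Qed.

(** Whatever choices are made, the procedure stops at the least level having an active node that
    shares a color. This level is below [L], and its number bounds the recourse. *)
Lemma procedure_extends_lt L : 0 < L -> girth_gt adj (2 * L) ->
  (forall ord : seq (node V) -> seq (node V), (forall s, perm_eq (ord s) s) ->
   exists j nd, [/\ j < L, nd \in nodes adj col u v ord j & shared adj col u nd != set0]) ->
  procedure_extends adj u v col (fun r => r < L).
Proof.
move=> L0 gL stop ord ordP.
pose P j := has (fun nf => nf.2 && (shared adj col u nf.1 != set0)) (level adj col u v ord j).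
have memL j nd b : j < L -> (nd, b) \in level adj col u v ord j = b && (nd \in nodes adj col u v ord j).
  by move=> jL; rewrite (mem_level adjS adjI adjuv col_proper col_uncolored L0 gL ordP) // ltnW.
have [j0 [nd0 [j0L nd0j sh0]]] := stop ord ordP.
have Pj0 : P j0 by apply/hasP; exists (nd0, true); rewrite ?memL.
have exP : exists j, P j by exists j0.
have Plt j : (forall i, P i -> j <= i) -> j < L by move=> /(_ _ Pj0) h; apply: leq_ltn_trans h j0L.
split.
  case: (ex_minnP exP) => i /hasP[[nd b] /= lnd /andP[bT /set0Pn[a sh]]] imin.
  exists (recolored col u nd a), i, nd, a; split=> //; split=> //.
    by rewrite bT in lnd.
  move=> j nd' ji nd'j; apply/eqP; apply: contraTT ji => sh'.
  by rewrite -leqNgt; apply: imin; apply/hasP; exists (nd', true).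
move=> _ [i [nd [a [[lnd sh before] ->]]]].
have iL : i < L.
  apply: Plt => j /hasP[[nd' b] /= lnd' /andP[bT]].
  apply: contraNT; rewrite -ltnNge => ji; apply/eqP; apply: before ji _.
  by rewrite bT in lnd'.
move: lnd; rewrite memL //= => ndi.
have [gnd sz] := mem_nodes adjS adjI adjuv col_proper col_uncolored L0 gL ordP (ltnW iL) ndi.
by have [p c r] := recolored_extends gnd sh; split=> //; apply: leq_ltn_trans r _; rewrite sz.
Qed.
End Stopping.

(** * Combinatorial conditions for small recourse *)

Section Instances.
Variables (V : finType) (adj : rel V) (Delta C : nat) (u v : V).
Variable (col : pcoloring V 'I_(Delta + C)).
Hypothesis inst : insertion_instance adj u v col.

Lemma degree_lt x : degree adj x < #|V|.
Proof.
have [[_ adjI] _ _ _ _] := inst.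
rewrite -cardsT; apply: proper_card; apply/properP; split; first exact: subsetT.
by exists x; rewrite ?inE // adjI.
Qed.

Lemma card_gt1 : 1 < #|V|.
Proof.
have [_ _ auv _ _] := inst; apply: leq_ltn_trans (degree_lt u).
by apply/card_gt0P; exists v; rewrite inE.
Qed.

(** The case [L = 1]: the root already shares a color, and the girth condition is automatic because
    a cycle has at least three vertices. *)
Lemma extends_of_root_degree : degree adj u + degree adj v < Delta + C + 2 ->
  procedure_extends adj u v col (fun r => r < 1).
Proof.
have [[adjS adjI] _ auv pc un] := inst => dlt.
apply: procedure_extends_lt => //; first by move=> c [].
move=> ord ordP; exists 0, (Defs.root v); split=> //; first by rewrite inE.
apply: contraTneq dlt => sh; rewrite -leqNgt.
by have := root_unshared_degree adjS adjI auv pc un sh; rewrite card_ord.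
Qed.

Lemma extends_of_large_degree : 2 * #|V| <= Delta ->
  procedure_extends adj u v col (fun r => r < 1).
Proof.
by move=> h; apply: extends_of_root_degree; have := degree_lt u; have := degree_lt v; lia.
Qed.

Lemma extends_of_few_vertices : 0 < C -> #|V| * (C + 1) <= Delta + C ^ 2 ->
  procedure_extends adj u v col (fun r => r < 1).
Proof.
move=> C0 h; apply: extends_of_root_degree; rewrite ltnNge; apply/negP => hd.
have := ins_degree inst u; have := ins_degree inst v.
have := degree_lt u; have := degree_lt v.
move: hd h; set a := degree _ _; set b := degree _ _; set n := #|V|.
(* The degree bounds give [n >= C + 3] and [Delta <= 2 * n - C - 4]. Then [h] would yield
   [n * (C - 1) <= C ^ 2 - C - 4], impossible for such [n] when [C >= 1]. *)
by move=> *; nia.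
Qed.

Lemma extends_of_girth l : girth_gt adj (2 * l.+2) ->
  #|V| < (C + 1) ^ l * (Delta + (C + 1) ^ 2) ->
  procedure_extends adj u v col (fun r => r < l.+2).
Proof.
have [[adjS adjI] dD auv pc un] := inst => gl nlt.
apply: procedure_extends_lt => // ord ordP; apply: contrapT => no.
move: nlt; rewrite ltnNge => /negP; apply.
apply: (walk_count adjS adjI auv pc un _ gl ordP (card_ord _) dD _ erefl) => //.
by move=> j nd jl ndj; apply/eqP/negPn/negP => sh; apply: no; exists j, nd.
Qed.
End Instances.

Lemma procedure_extends_weaken (V : finType) (adj : rel V) (K : finType) (u v : V)
    (col : pcoloring V K) (P Q : nat -> Prop) :
  (forall r, P r -> Q r) -> procedure_extends adj u v col P -> procedure_extends adj u v col Q.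
Proof.
move=> PQ h ord ordP; have [ex all] := h ord ordP; split=> // col' /all[p c r].
by split=> //; apply: PQ.
Qed.

Import Order.TTheory GRing.Theory Num.Theory.
Local Open Scope ring_scope.

(** * Real estimates *)

Section RealBounds.
Variable R : realType.

Lemma girth_gt_of_le (V : finType) (adj : rel V) (m : nat) :
  ((m.+1%:R : R)%:E <= girth adj R)%E -> girth_gt adj m.
Proof.
move=> /ereal_infP h c cc.
by have := h _ (ex_intro2 _ _ c cc erefl); rewrite lee_fin ler_nat.
Qed.

Lemma ln_natS (C : nat) : (1 <= C)%N -> 0 < ln 2 :> R /\ ln 2 <= ln (C%:R + 1) :> R.
Proof.
move=> C1; split; first by rewrite ln_gt0 // ltr1n.
have h : 1 <= C%:R :> R by rewrite ler1n.
by rewrite ler_ln ?posrE; lra.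
Qed.

Section Instance.
Variables (V : finType) (adj : rel V) (Delta C : nat) (u v : V).
Variable (col : pcoloring V 'I_(Delta + C)).
Hypotheses (C1 : (1 <= C)%N) (inst : insertion_instance adj u v col).

Local Notation n := #|V|.
Local Notation b := (beta R n Delta C).

Let n_gt0 : 0 < n%:R :> R.
Proof. by rewrite ltr0n ltnW // (card_gt1 inst). Qed.

Let D_gt0 : 0 < Delta%:R + C%:R ^+ 2 :> R.
Proof. by rewrite ltr_wpDl ?ler0n // exprn_gt0 // ltr0n. Qed.

Lemma beta_le_nat (l : nat) : b <= l.+2%:R ->
  n%:R <= (C%:R + 1) ^+ l * (Delta%:R + C%:R ^+ 2) :> R.
Proof.
have [l2 lC] := ln_natS C1.
have c0 : 0 < C%:R + 1 :> R by rewrite natr1 ltr0n.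
rewrite /beta -(natr1 l.+1) -(natr1 l) -addrA lerD2r ler_pdivrMr; last exact: lt_le_trans lC.
rewrite [l%:R * _]mulr_natl -lnXn // ler_ln ?posrE ?divr_gt0 ?exprn_gt0 //.
by rewrite ler_pdivrMr.
Qed.

Lemma beta_le1 : b <= 1 -> n%:R * (C%:R + 1) <= Delta%:R + C%:R ^+ 2 :> R.
Proof.
have [l2 lC] := ln_natS C1.
have c0 : 0 < C%:R + 1 :> R by rewrite natr1 ltr0n.
move=> b1; have : ln (n%:R / (Delta%:R + C%:R ^+ 2)) / ln (C%:R + 1) <= - 1 :> R.
  by move: b1; rewrite /beta; lra.
rewrite ler_pdivrMr ?(lt_le_trans l2) // mulN1r -lnV ?posrE //.
rewrite ler_ln ?posrE ?divr_gt0 ?invr_gt0 //.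
by rewrite ler_pdivrMr // ler_pdivlMl // mulrC.
Qed.

(** Since [n >= 2] and [C >= 1], the hypothesis gives [Delta + C ^ 2 < n * (C + 1) ^ 2], so the
    logarithm in [beta] exceeds -2. *)
Lemma beta_gt0 : (Delta < 2 * n)%N -> 0 < b.
Proof.
move=> Dn; have [l2 lC] := ln_natS C1.
have c0 : 0 < C%:R + 1 :> R by rewrite natr1 ltr0n.
suff : - 2 < ln (n%:R / (Delta%:R + C%:R ^+ 2)) / ln (C%:R + 1) :> R by rewrite /beta; lra.
rewrite ltr_pdivlMr ?(lt_le_trans l2) // mulNr [2 * _]mulr_natl -lnXn // -lnV ?posrE ?exprn_gt0 //.
rewrite ltr_ln ?posrE ?divr_gt0 ?invr_gt0 ?exprn_gt0 //.
rewrite ltr_pdivlMr // mulrC ltr_pdivrMr ?exprn_gt0 //.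
rewrite natr1 -!natrX -natrM -natrD ltr_nat.
by have := card_gt1 inst; move: Dn; set m := #|V|; nia.
Qed.

Lemma recourse_lt_beta : 0 < b -> ((2 * (Num.ceil b)%:~R + 1)%:E <= girth adj R)%E ->
  procedure_extends adj u v col (fun r => r%:R < b).
Proof.
move=> b0; have : 0 < Num.ceil b by rewrite ceil_gt0.
have /andP[bgt ble] := ceil_itv b.
case: (Num.ceil b) bgt ble => // -[//|l] bgt ble _ gb.
have gl : girth_gt adj (2 * l.+1).
  by apply: girth_gt_of_le; rewrite -natr1 natrM.
(* [l.+1] is the ceiling of [beta], so a smaller natural number is at most the ceiling minus 1,
   which lies strictly below [beta]. *)
have weak : forall r : nat, (r < l.+1)%N -> r%:R < b.
  move=> r rl; apply: le_lt_trans bgt; rewrite intrB -!pmulrn.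
  by rewrite lerBrDr natr1 ler_nat.
apply: (procedure_extends_weaken weak); rewrite -pmulrn in ble.
case: l ble {bgt gb weak} gl => [|l] ble gl.
  apply: (extends_of_few_vertices inst) => //.
  by rewrite -(ler_nat R) natrM !natrD natrX; apply: beta_le1.
apply: (extends_of_girth inst) => //.
rewrite -(ltr_nat R) natrM natrX !natrD natrX natrD.
(* Strictness comes from [C ^ 2 < (C + 1) ^ 2]: the count of walks beats the bound in the definition
   of [beta]. *)
apply: le_lt_trans (beta_le_nat ble) _.
rewrite ltr_pM2l ?exprn_gt0 ?natr1 ?ltr0n //.
by rewrite ltrD2l ltr_pXn2r ?nnegrE ?ler0n ?ltr_nat.
Qed.

(** The ceiling of [beta] is below [x + 1], so [2 * x + 3] absorbs the rounding. *)
Lemma recourse_lt_of_beta_le (x : R) : (Delta < 2 * n)%N -> b <= x ->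
  ((2 * x + 3)%:E <= girth adj R)%E -> procedure_extends adj u v col (fun r => r%:R <= x).
Proof.
move=> Dn bx gx.
apply: procedure_extends_weaken (recourse_lt_beta (beta_gt0 Dn) _).
  by move=> r rb; apply/ltW/(lt_le_trans rb).
apply: le_trans gx; rewrite lee_fin.
by have := ceilB1_lt b; rewrite intrB => h; move: h bx; lra.
Qed.
End Instance.

(** * Asymptotic consequences *)

Lemma logarithmic_recourse (C0 : nat) (t : R) : 1 < t ->
  exists k B : R, [/\ 0 < k, 0 < B &
    forall (V : finType) (adj : rel V) (Delta C : nat) (u v : V)
      (col : pcoloring V 'I_(Delta + C)),
      (1 <= C <= C0)%N -> insertion_instance adj u v col ->
      t <= #|V|%:R / Delta%:R ->
      ((k * ln (#|V|%:R / Delta%:R))%:E <= girth adj R)%E ->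
      procedure_extends adj u v col (fun r => r%:R <= B * ln (#|V|%:R / Delta%:R))].
Proof.
move=> t1; have lt0 : 0 < ln t by rewrite ln_gt0.
have [l2 _] := ln_natS (leqnn 1).
(* With X the logarithm of n / Delta, [beta] is at most [X / ln 2 + 2], and [1 <= X / ln t] absorbs
   additive constants: 2 in [B], and 2 * 2 + 3 = 7 in [k]. *)
exists (2 / ln 2 + 7 / ln t), ((ln 2)^-1 + 2 / ln t); split.
- by rewrite addr_gt0 ?divr_gt0.
- by rewrite addr_gt0 ?divr_gt0 ?invr_gt0.
move=> V adj Delta C u v col /andP[C1 _] inst tn; set X := ln (_ / _) => gX.
have [_ lC] := ln_natS C1.
have q0 : 0 < #|V|%:R / Delta%:R :> R by apply: lt_le_trans tn; lra.
(* Division by zero gives 0, so [Delta = 0] would contradict [t <= #|V|%:R / Delta%:R]. *)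
have D0 : 0 < Delta%:R :> R.
  rewrite lt0r ler0n andbT; apply: contraTneq q0 => ->.
  by rewrite invr0 mulr0 ltxx.
have t0 : 0 < t by apply: lt_trans t1.
have tX : ln t <= X by rewrite /X ler_ln ?posrE.
have X0 : 0 < X by apply: lt_le_trans tX.
have Dn : (Delta < #|V|)%N.
  rewrite -(ltr_nat R); have : t * Delta%:R <= #|V|%:R by rewrite -ler_pdivlMr.
  by apply: lt_le_trans; rewrite ltr_pMl.
have one : 1 <= X / ln t by rewrite ler_pdivlMr // mul1r.
apply: (recourse_lt_of_beta_le C1 inst); first by lia.
  have h1 : ln (#|V|%:R / (Delta%:R + C%:R ^+ 2)) <= X.
    have n0 : 0 < #|V|%:R :> R by rewrite ltr0n; lia.
    have d0 : Delta%:R <= Delta%:R + C%:R ^+ 2 :> R by rewrite lerDl exprn_ge0 ?ler0n.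
    have d1 := lt_le_trans D0 d0.
    by rewrite /X ler_ln ?posrE ?divr_gt0 // ler_pM2l // lef_pV2 ?posrE.
  have h2 : ln (#|V|%:R / (Delta%:R + C%:R ^+ 2)) / ln (C%:R + 1) <= X / ln 2.
    apply: (@le_trans _ _ (X / ln (C%:R + 1))).
      by apply: (ler_wpM2r _ h1); rewrite invr_ge0 ltW // (lt_le_trans l2).
    by rewrite ler_pM2l // lef_pV2 ?posrE // (lt_le_trans l2).
  by rewrite /beta mulrDl [_^-1 * X]mulrC; move: h2 one; rewrite -mulrA [_^-1 * X]mulrC; lra.
apply: le_trans gX; rewrite lee_fin.
have e1 : (2 / ln 2 + 7 / ln t) * X = 2 * (X / ln 2) + 7 * (X / ln t) by ring.
have e2 : ((ln 2)^-1 + 2 / ln t) * X = X / ln 2 + 2 * (X / ln t) by ring.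
by rewrite e1 e2; lra.
Qed.

(** With m the absolute value of [ln c], the hypothesis gives [ln Delta <= 2 * ln (C + 1) + 2 * m].
    Since [C + 1 >= 2], m is at most [ln (C + 1) * (m / ln 2)], whence the choice of [d]. *)
Lemma ln_succ_ge (c : R) : 0 < c -> exists2 d : R, 0 < d &
  forall Delta C : nat, (1 <= C)%N -> (2 <= Delta)%N -> c * Num.sqrt Delta%:R <= C%:R ->
    d * ln Delta%:R <= ln (C%:R + 1) :> R.
Proof.
move=> c0; have [l2 _] := ln_natS (leqnn 1).
set m := `|ln c|; have m0 : 0 <= m by exact: normr_ge0.
have M : 0 < 2 * (1 + m / ln 2) by rewrite mulr_gt0 // ltr_wpDr ?divr_ge0 // ltW.
exists (2 * (1 + m / ln 2))^-1; first by rewrite invr_gt0.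
move=> Delta C C1 D2 cD; rewrite mulrC ler_pdivrMr //.
have [_ lC] := ln_natS C1.
have C0 : 0 < C%:R :> R by rewrite ltr0n.
have D0 : 0 < Delta%:R :> R by rewrite ltr0n; lia.
have h1 : ln C%:R <= ln (C%:R + 1) :> R by rewrite ler_ln ?posrE //; lra.
have h2 : 2 * ln c + ln Delta%:R <= 2 * ln C%:R :> R.
  rewrite !mulr_natl -!lnXn // -lnM ?posrE ?exprn_gt0 //.
  rewrite ler_ln ?posrE ?mulr_gt0 ?exprn_gt0 //.
  rewrite -[Delta%:R in leLHS]sqr_sqrtr ?ler0n // -exprMn.
  by rewrite ler_pXn2r ?nnegrE ?mulr_ge0 ?sqrtr_ge0 // ltW.
have h3 : - m <= ln c by rewrite lerNl ler_normr lexx orbT.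
have h4 : m <= ln (C%:R + 1) * (m / ln 2).
  by rewrite mulrA ler_pdivlMr // mulrC ler_wpM2r.
by move: h1 h2 h3 h4; lra.
Qed.

Lemma logarithmic_recourse_large_palette (c : R) : 0 < c ->
  exists k B : R, [/\ 0 < k, 0 < B &
    forall (V : finType) (adj : rel V) (Delta C : nat) (u v : V)
      (col : pcoloring V 'I_(Delta + C)),
      (1 <= C)%N -> c * Num.sqrt Delta%:R <= C%:R ->
      insertion_instance adj u v col -> (2 <= Delta)%N ->
      ((k * (ln #|V|%:R / ln Delta%:R))%:E <= girth adj R)%E ->
      procedure_extends adj u v col (fun r => r%:R <= B * (ln #|V|%:R / ln Delta%:R))].
Proof.
move=> /ln_succ_ge[d d0 hd].
(* Here [beta] is at most [L / d + 2], and [1 <= 2 * L] turns 2 into [4 * L]. Doubling and adding 3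
   gives [2 * L / d + 8 * L + 6 * L]. *)
exists (2 / d + 14), (d^-1 + 4); split.
- by rewrite addr_gt0 ?divr_gt0.
- by rewrite addr_gt0 ?invr_gt0.
move=> V adj Delta C u v col C1 cC inst D2; set L := ln _ / ln Delta%:R => gL.
have n1 := card_gt1 inst.
have lD : 0 < ln Delta%:R :> R by rewrite ln_gt0 // ltr1n.
have ln0 : 0 < ln #|V|%:R :> R by rewrite ln_gt0 // ltr1n.
have L0 : 0 < L by rewrite divr_gt0.
have B0 : 0 < d^-1 + 4 by rewrite addr_gt0 ?invr_gt0.
(* For very large [Delta] positivity of [beta] is not guaranteed, but there the root already works
   and the recourse is 0. *)
have [Dn|Dn] := ltnP Delta (2 * #|V|); last first.
  apply: procedure_extends_weaken (extends_of_large_degree inst Dn) => r.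
  by rewrite ltnS leqn0 => /eqP ->; rewrite mulr_ge0 // ltW.
(* This amounts to [Delta <= n ^ 2], true because [Delta < 2 * n] and [n >= 2]. *)
have L2 : 1 <= 2 * L.
  rewrite /L mulrA ler_pdivlMr // mul1r mulr_natl -lnXn ?ltr0n; last by lia.
  rewrite ler_ln ?posrE ?exprn_gt0 ?ltr0n; [|by lia..].
  by rewrite -natrX ler_nat; move: Dn n1; set m := #|V|; nia.
have lC := hd _ _ C1 D2 cC; have [l2 l2C] := ln_natS C1.
have bL : beta R #|V| Delta C <= (d^-1 + 4) * L.
  have h1 : ln (#|V|%:R / (Delta%:R + C%:R ^+ 2)) <= ln #|V|%:R :> R.
    have n0 : 0 < #|V|%:R :> R by rewrite ltr0n; lia.
    have p1 : 1 <= Delta%:R + C%:R ^+ 2 :> R.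
      by rewrite -natrX -natrD ler1n; lia.
    have p0 := lt_le_trans ltr01 p1.
    by rewrite ler_ln ?posrE ?divr_gt0 // ler_pdivrMr // ler_peMr // ltW.
  have h2 : ln (#|V|%:R / (Delta%:R + C%:R ^+ 2)) / ln (C%:R + 1) <= d^-1 * L.
    apply: (@le_trans _ _ (ln #|V|%:R / ln (C%:R + 1))).
      by apply: (ler_wpM2r _ h1); rewrite invr_ge0 ltW // (lt_le_trans l2).
    rewrite /L mulrCA ler_pM2l // -invfM lef_pV2 ?posrE ?mulr_gt0 //.
    exact: lt_le_trans l2C.
  by rewrite /beta mulrDl; lra.
apply: (recourse_lt_of_beta_le C1 inst Dn bL).
apply: le_trans gL; rewrite lee_fin.
have -> : (2 / d + 14) * L = 2 * (d^-1 * L) + 14 * L by ring.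
have -> : (d^-1 + 4) * L = d^-1 * L + 4 * L by ring.
by lra.
Qed.
End RealBounds.

Theorem mainTheorem10 (R : realType) :
  (* the recourse bound *)
  (forall (V : finType) (adj : rel V) (Delta C : nat) (u v : V)
     (col : pcoloring V 'I_(Delta + C)),
     (1 <= C)%N ->
     insertion_instance adj u v col ->
     0 < beta R #|V| Delta C ->
     ((2 * (Num.ceil (beta R #|V| Delta C))%:~R + 1)%:E <= girth adj R)%E ->
     procedure_extends adj u v col
       (fun r => r%:R < beta R #|V| Delta C))
  /\
  (* C = O(1) *)
  (forall (C0 : nat) (t : R), 1 < t ->
     exists k B : R, [/\ 0 < k, 0 < B &
       forall (V : finType) (adj : rel V) (Delta C : nat) (u v : V)
         (col : pcoloring V 'I_(Delta + C)),
         (1 <= C <= C0)%N ->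
         insertion_instance adj u v col ->
         t <= #|V|%:R / Delta%:R ->
         ((k * ln (#|V|%:R / Delta%:R))%:E <= girth adj R)%E ->
         procedure_extends adj u v col
           (fun r => r%:R <= B * ln (#|V|%:R / Delta%:R))])
  /\
  (* C = Omega(sqrt Delta) *)
  (forall c : R, 0 < c ->
     exists k B : R, [/\ 0 < k, 0 < B &
       forall (V : finType) (adj : rel V) (Delta C : nat) (u v : V)
         (col : pcoloring V 'I_(Delta + C)),
         (1 <= C)%N ->
         c * Num.sqrt Delta%:R <= C%:R ->
         insertion_instance adj u v col ->
         (2 <= Delta)%N ->
         ((k * (ln #|V|%:R / ln Delta%:R))%:E <= girth adj R)%E ->
         procedure_extends adj u v col
           (fun r => r%:R <= B * (ln #|V|%:R / ln Delta%:R))]).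
Proof.
split; last split.
- by move=> V adj Delta C u v col C1 inst; exact: recourse_lt_beta.
- exact: logarithmic_recourse.
- exact: logarithmic_recourse_large_palette.
Qed.
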